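(* For each of the pairs $(L,\ell)=(\mathbf{IL}^-(\mathbf{J2}_+,\mathbf{J5}),\ \mathbf{il}^-(\mathbf{I2},\mathbf{I3}))$ and $(L,\ell)=(\mathbf{IL},\ \mathbf{il}^-(\mathbf{J1}^u,\mathbf{I2},\mathbf{I3}))$, and every $\mathcal{L}(\Box,\mathbf{I})$-formula $A$: if $L\vdash A$ then $\ell\vdash A$.
   Context: The language $\mathcal{L}(\Box,\rhd)$ consists of propositional variables, $\bot$, $\to$, unary $\Box$ and binary $\rhd$; other connectives as usual, $\Diamond A:\equiv\neg\Box\neg A$, $\mathbf{I}A:\equiv\top\rhd A$; $\mathcal{L}(\Box,\mathbf{I})$-formulas are those built from variables and $\bot$ by $\to$, $\Box$, $\mathbf{I}$. The logic $\mathbf{IL}^-$ has as axioms all tautologies, $\Box(A\to B)\to(\Box A\to\Box B)$, $\Box(\Box A\to A)\to\Box A$, $\mathbf{J3}$: $(A\rhd C)\land(B\rhd C)\to(A\lor B)\rhd C$, $\mathbf{J6}$: $\Box A\leftrightarrow(\neg A\rhd\bot)$; rules: Modus Ponens, Necessitation, from $A\to B$ infer $(C\rhd A)\to(C\rhd B)$, and from $A\to B$ infer $(B\rhd C)\to(A\rhd C)$. Schemata: $\mathbf{J1}$: $\Box(A\to B)\to A\rhd B$; $\mathbf{J2}_+$: $(A\rhd(B\lor C))\land(B\rhd C)\to A\rhd C$; $\mathbf{J5}$: $\Diamond A\rhd A$. $L(\Sigma_1,\dots,\Sigma_k)$ is $L$ with schemata $\Sigma_i$ added as axioms; $\mathbf{IL}:=\mathbf{IL}^-(\mathbf{J1},\mathbf{J2}_+,\mathbf{J5})$.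 The logic $\mathbf{il}^-$ has as axioms all tautologies of $\mathcal{L}(\Box,\mathbf{I})$, $\Box(A\to B)\to(\Box A\to\Box B)$, $\Box(\Box A\to A)\to\Box A$, $\Box\bot\leftrightarrow\mathbf{I}\bot$; rules Modus Ponens, Necessitation, and from $A\to B$ infer $\mathbf{I}A\to\mathbf{I}B$. Schemata: $\mathbf{I2}$: $\Box(A\to B)\to(\mathbf{I}A\to\mathbf{I}B)$; $\mathbf{I3}$: $\mathbf{I}(A\lor\Diamond A)\to\mathbf{I}A$; $\mathbf{J1}^u$: $\Box A\to\mathbf{I}A$. *)

(* Defs.v *)
From Stdlib Require Export List.
Export ListNotations.

Inductive form : Type :=
| Var (n : nat)
| Bot
| Imp (A B : form)
| Box (A : form)
| Rhd (A B : form).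

Declare Scope form_scope.
Delimit Scope form_scope with form.
Bind Scope form_scope with form.

Definition Neg (A : form) : form := Imp A Bot.
Definition Top : form := Neg Bot.
Definition Or (A B : form) : form := Imp (Neg A) B.
Definition And (A B : form) : form := Neg (Imp A (Neg B)).
Definition Iff (A B : form) : form := And (Imp A B) (Imp B A).
Definition Dia (A : form) : form := Neg (Box (Neg A)).

Notation "~ A" := (Neg A) : form_scope.
Notation "A /\ B" := (And A B) : form_scope.
Notation "A \/ B" := (Or A B) : form_scope.
Notation "A |> B" := (Rhd A B) (at level 87, no associativity) : form_scope.
Notation "A --> B" := (Imp A B) (at level 90, right associativity) : form_scope.
Notation "A <-> B" := (Iff A B) : form_scope.

(** Truth-functional evaluation: variables and formulas with outermost [Box] or
    [Rhd] are the propositional atoms, on which [v] is arbitrary; the values of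
    [v] on other formulas are not used. *)
Fixpoint eval (v : form -> bool) (A : form) : bool :=
  match A with
  | Bot => false
  | Imp B C => implb (eval v B) (eval v C)
  | Var _ | Box _ | Rhd _ _ => v A
  end.

Definition tautology (A : form) : Prop := forall v, eval v A = true.

Inductive J1 : form -> Prop :=
| J1_inst A B : J1 (Box (A --> B) --> A |> B).

Inductive J2plus : form -> Prop :=
| J2plus_inst A B C : J2plus ((A |> B \/ C) /\ (B |> C) --> A |> C).

Inductive J5 : form -> Prop :=
| J5_inst A : J5 (Dia A |> A).

(** [ILminus Ss] is the set of theorems of IL^- extended with the schemata
    in [Ss]. *)
Inductive ILminus (Ss : list (form -> Prop)) : form -> Prop :=
| ILm_taut A : tautology A -> ILminus Ss A
| ILm_K A B : ILminus Ss (Box (A --> B) --> Box A --> Box B)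
| ILm_L A : ILminus Ss (Box (Box A --> A) --> Box A)
| ILm_J3 A B C : ILminus Ss ((A |> C) /\ (B |> C) --> A \/ B |> C)
| ILm_J6 A : ILminus Ss (Box A <-> (~ A |> Bot))
| ILm_schema S A : In S Ss -> S A -> ILminus Ss A
| ILm_MP A B : ILminus Ss (A --> B) -> ILminus Ss A -> ILminus Ss B
| ILm_Nec A : ILminus Ss A -> ILminus Ss (Box A)
| ILm_R1 A B C : ILminus Ss (A --> B) -> ILminus Ss (C |> A --> C |> B)
| ILm_R2 A B C : ILminus Ss (A --> B) -> ILminus Ss (B |> C --> A |> C).

Definition IL : form -> Prop := ILminus [J1; J2plus; J5].

Inductive iform : Type :=
| iVar (n : nat)
| iBot
| iImp (A B : iform)
| iBox (A : iform)
| iI (A : iform).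

Declare Scope iform_scope.
Delimit Scope iform_scope with iform.
Bind Scope iform_scope with iform.

Definition iNeg (A : iform) : iform := iImp A iBot.
Definition iOr (A B : iform) : iform := iImp (iNeg A) B.
Definition iAnd (A B : iform) : iform := iNeg (iImp A (iNeg B)).
Definition iIff (A B : iform) : iform := iAnd (iImp A B) (iImp B A).
Definition iDia (A : iform) : iform := iNeg (iBox (iNeg A)).

Notation "A \/ B" := (iOr A B) : iform_scope.
Notation "A --> B" := (iImp A B) : iform_scope.
Notation "A <-> B" := (iIff A B) : iform_scope.

(** An L(Box, I)-formula read as an L(Box, Rhd)-formula, [I A] being an
    abbreviation of [Top |> A]. *)
Fixpoint embed (A : iform) : form :=
  match A with
  | iVar n => Var n
  | iBot => Bot
  | iImp B C => Imp (embed B) (embed C)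
  | iBox B => Box (embed B)
  | iI B => Rhd Top (embed B)
  end.

Fixpoint ieval (v : iform -> bool) (A : iform) : bool :=
  match A with
  | iBot => false
  | iImp B C => implb (ieval v B) (ieval v C)
  | iVar _ | iBox _ | iI _ => v A
  end.

Definition itautology (A : iform) : Prop := forall v, ieval v A = true.

Inductive I2 : iform -> Prop :=
| I2_inst A B : I2 (iBox (A --> B) --> iI A --> iI B).

Inductive I3 : iform -> Prop :=
| I3_inst A : I3 (iI (A \/ iDia A) --> iI A).

Inductive J1u : iform -> Prop :=
| J1u_inst A : J1u (iBox A --> iI A).

(** [ilminus Ss] is the set of theorems of il^- extended with the schemata
    in [Ss]. *)
Inductive ilminus (Ss : list (iform -> Prop)) : iform -> Prop :=
| ilm_taut A : itautology A -> ilminus Ss A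
| ilm_K A B : ilminus Ss (iBox (A --> B) --> iBox A --> iBox B)
| ilm_L A : ilminus Ss (iBox (iBox A --> A) --> iBox A)
| ilm_IBot : ilminus Ss (iBox iBot <-> iI iBot)
| ilm_schema S A : In S Ss -> S A -> ilminus Ss A
| ilm_MP A B : ilminus Ss (A --> B) -> ilminus Ss A -> ilminus Ss B
| ilm_Nec A : ilminus Ss A -> ilminus Ss (iBox A)
| ilm_RI A B : ilminus Ss (A --> B) -> ilminus Ss (iI A --> iI B).

(* Main.v *)
(** Interpret [A |> B] inside L(Box, I) as [I B \/ Box (A --> Dia B)], or, when J1
    is present, as [I B \/ Box (A --> B \/ Dia B)]. Under this reading the axioms and
    rules of the binary logic become theorems of the unary one (J2+ is where I2
    and I3 enter), and [Top |> B] becomes equivalent to [I B]: [Box (Dia B)] implies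
    [Box Bot] by Löb, hence [I Bot]; and [Box (B \/ Dia B)] implies
    [I (B \/ Dia B)] by J1u, hence [I B] by I3. *)
Require Import Defs.

Local Open Scope iform_scope.

(** Truth tables over the visible atoms: a schematic subformula enters as its stuck [ieval v A], a
    modal one as [v A]. *)
Ltac solve_taut :=
  apply ilm_taut; let v := fresh "v" in intro v; cbn;
  repeat match goal with
    | |- context [ieval v ?A] => destruct (ieval v A)
    | |- context [v ?A] => destruct (v A)
    end; reflexivity.

(** Chained cuts put proved theorems in front of the goal as antecedents, until only a tautology
    remains. *)
Lemma ilm_cut Ss A B : ilminus Ss A -> ilminus Ss (A --> B) -> ilminus Ss B.
Proof. intros HA HAB; exact (ilm_MP _ _ _ HAB HA). Qed.

Lemma ilm_box_mono Ss A B :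
  ilminus Ss (A --> B) -> ilminus Ss (iBox A --> iBox B).
Proof.
  intros H; apply (ilm_MP _ _ _ (ilm_K _ _ _)), ilm_Nec, H.
Qed.

Lemma ilm_box_mono2 Ss A B C :
  ilminus Ss (A --> B --> C) -> ilminus Ss (iBox A --> iBox B --> iBox C).
Proof.
  intros H; apply ilm_box_mono in H.
  apply (ilm_cut _ _ _ H), (ilm_cut _ _ _ (ilm_K _ B C)); solve_taut.
Qed.

Lemma ilm_4 Ss A : ilminus Ss (iBox A --> iBox (iBox A)).
Proof.
  (* Löb applied to [A /\ Box A] *)
  set (B := iAnd A (iBox A)).
  assert (H1 : ilminus Ss (iBox B --> iBox A)) by
    (apply ilm_box_mono; unfold B; solve_taut).
  assert (H2 : ilminus Ss (iBox B --> iBox (iBox A))) by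
    (apply ilm_box_mono; unfold B; solve_taut).
  assert (H3 : ilminus Ss (iBox A --> iBox (iBox B --> B))).
  { apply ilm_box_mono, (ilm_cut _ _ _ H1); unfold B; solve_taut. }
  apply (ilm_cut _ _ _ H2), (ilm_cut _ _ _ H3), (ilm_cut _ _ _ (ilm_L _ B)).
  solve_taut.
Qed.

(** [iDia A] refutes [iBox (iNeg A)], so it implies Löb's premise for [iNeg A]. Löb and transitivity
    then give [iBox (iBox (iNeg A))], which contradicts [iDia A] under the box. *)
Lemma ilm_box_dia Ss A : ilminus Ss (iBox (iDia A) --> iBox iBot).
Proof.
  assert (H1 : ilminus Ss (iBox (iDia A) --> iBox (iBox (iNeg A) --> iNeg A))) by
    (apply ilm_box_mono; solve_taut).
  assert (H2 : ilminus Ss (iBox (iDia A) --> iBox (iBox (iNeg A)) --> iBox iBot)) by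
    (apply ilm_box_mono2; solve_taut).
  apply (ilm_cut _ _ _ H1), (ilm_cut _ _ _ H2), (ilm_cut _ _ _ (ilm_L _ (iNeg A))),
    (ilm_cut _ _ _ (ilm_4 _ (iNeg A))).
  solve_taut.
Qed.

(** The flag [r] marks the presence of [J1], so that one argument serves both pairs of logics. *)
Definition reach (r : bool) (B : iform) : iform :=
  if r then B \/ iDia B else iDia B.

Definition irhd (r : bool) (A B : iform) : iform :=
  iI B \/ iBox (A --> reach r B).

Fixpoint interp (r : bool) (A : form) : iform :=
  match A with
  | Var n => iVar n
  | Bot => iBot
  | Imp B C => interp r B --> interp r C
  | Box B => iBox (interp r B)
  | Rhd B C => irhd r (interp r B) (interp r C)
  end.

(** Pulling a valuation back along the translation shows that tautologies go to tautologies; [Rhd]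
    formulas are atoms for [eval], so their compound images do no harm. *)
Lemma ieval_interp r v A :
  ieval v (interp r A) = eval (fun B => ieval v (interp r B)) A.
Proof.
  induction A as [n| |A IHA B IHB|A IHA|A IHA B IHB]; try reflexivity.
  cbn; now rewrite IHA, IHB.
Qed.

Lemma ilm_dia_mono Ss A B :
  ilminus Ss (A --> B) -> ilminus Ss (iDia A --> iDia B).
Proof.
  intros H.
  assert (H1 : ilminus Ss (iBox (iNeg B) --> iBox (iNeg A))) by
    (apply ilm_box_mono, (ilm_cut _ _ _ H); solve_taut).
  apply (ilm_cut _ _ _ H1); solve_taut.
Qed.

Lemma reach_mono Ss r A B :
  ilminus Ss (A --> B) -> ilminus Ss (reach r A --> reach r B).
Proof.
  intros H; pose proof (ilm_dia_mono _ _ _ H) as H1; destruct r; cbn.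
  - apply (ilm_cut _ _ _ H), (ilm_cut _ _ _ H1); solve_taut.
  - exact H1.
Qed.

Lemma irhd_mono_r Ss r A B C :
  ilminus Ss (A --> B) -> ilminus Ss (irhd r C A --> irhd r C B).
Proof.
  intros H.
  assert (H1 : ilminus Ss (iBox (C --> reach r A) --> iBox (C --> reach r B))) by
    (apply ilm_box_mono, (ilm_cut _ _ _ (reach_mono _ r _ _ H)); solve_taut).
  apply (ilm_cut _ _ _ H1), (ilm_cut _ _ _ (ilm_RI _ _ _ H)); solve_taut.
Qed.

Lemma irhd_anti_l Ss r A B C :
  ilminus Ss (A --> B) -> ilminus Ss (irhd r B C --> irhd r A C).
Proof.
  intros H.
  assert (H1 : ilminus Ss (iBox (B --> reach r C) --> iBox (A --> reach r C))) by
    (apply ilm_box_mono, (ilm_cut _ _ _ H); solve_taut).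
  apply (ilm_cut _ _ _ H1); solve_taut.
Qed.

Lemma irhd_J3 Ss r A B C :
  ilminus Ss (iAnd (irhd r A C) (irhd r B C) --> irhd r (A \/ B) C).
Proof.
  assert (H : ilminus Ss (iBox (A --> reach r C) --> iBox (B --> reach r C) -->
                          iBox (A \/ B --> reach r C))) by
    (apply ilm_box_mono2; solve_taut).
  apply (ilm_cut _ _ _ H); solve_taut.
Qed.

Lemma irhd_J6 Ss r A : ilminus Ss (iBox A <-> irhd r (iNeg A) iBot).
Proof.
  (* With [reach r iBot] refutable, the box disjunct is equivalent to [iBox A]; the other disjunct
     [iI iBot] is [iBox iBot], which implies [iBox A]. *)
  assert (H0 : ilminus Ss (iNeg (reach r iBot))).
  { assert (H : ilminus Ss (iBox (iNeg iBot))) by (apply ilm_Nec; solve_taut).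
    apply (ilm_cut _ _ _ H); destruct r; solve_taut. }
  assert (H1 : ilminus Ss (iBox iBot --> iBox A)) by
    (apply ilm_box_mono; solve_taut).
  assert (H2 : ilminus Ss (iBox A --> iBox (iNeg A --> reach r iBot))) by
    (apply ilm_box_mono; solve_taut).
  assert (H3 : ilminus Ss (iBox (iNeg A --> reach r iBot) --> iBox A)) by
    (apply ilm_box_mono, (ilm_cut _ _ _ H0); solve_taut).
  apply (ilm_cut _ _ _ H1), (ilm_cut _ _ _ H2), (ilm_cut _ _ _ H3),
    (ilm_cut _ _ _ (ilm_IBot Ss)); solve_taut.
Qed.

Lemma irhd_J5 Ss r A : ilminus Ss (irhd r (iDia A) A).
Proof.
  assert (H : ilminus Ss (iBox (iDia A --> reach r A))) by
    (apply ilm_Nec; destruct r; solve_taut).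
  apply (ilm_cut _ _ _ H); solve_taut.
Qed.

Lemma irhd_J1 Ss A B : ilminus Ss (iBox (A --> B) --> irhd true A B).
Proof.
  assert (H : ilminus Ss (iBox (A --> B) --> iBox (A --> reach true B))) by
    (apply ilm_box_mono; solve_taut).
  apply (ilm_cut _ _ _ H); solve_taut.
Qed.

(** By contraposition: [iBox (iNeg C)] and transitivity refute [reach r C] at every successor, hence
    also [B] there. *)
Lemma reach_dia Ss r B C :
  ilminus Ss (iBox (B --> reach r C) --> iDia (B \/ C) --> iDia C).
Proof.
  assert (H : ilminus Ss (iBox (iAnd (iNeg C) (iBox (iNeg C))) -->
              iBox (B --> reach r C) --> iBox (iNeg (B \/ C)))) by
    (apply ilm_box_mono2; destruct r; solve_taut).
  assert (H1 : ilminus Ss (iBox (iNeg C) --> iBox (iBox (iNeg C)) -->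
               iBox (iAnd (iNeg C) (iBox (iNeg C))))) by
    (apply ilm_box_mono2; solve_taut).
  apply (ilm_cut _ _ _ H), (ilm_cut _ _ _ H1), (ilm_cut _ _ _ (ilm_4 _ (iNeg C))).
  solve_taut.
Qed.

Lemma reach_trans Ss r A B C :
  ilminus Ss (iBox (A --> reach r (B \/ C)) --> iBox (B --> reach r C) -->
              iBox (A --> reach r C)).
Proof.
  set (P := B --> reach r C).
  (* Under the box, [P] handles the case [B] and [iBox P], through [reach_dia], the case
     [iDia (B \/ C)]; transitivity supplies [iBox P]. *)
  assert (H : ilminus Ss (iBox (A --> reach r (B \/ C)) --> iBox (iAnd P (iBox P)) -->
              iBox (A --> reach r C))).
  { apply ilm_box_mono2, (ilm_cut _ _ _ (reach_dia _ r B C)); unfold P.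
    destruct r; solve_taut. }
  assert (H1 : ilminus Ss (iBox P --> iBox (iBox P) --> iBox (iAnd P (iBox P)))) by
    (apply ilm_box_mono2; solve_taut).
  apply (ilm_cut _ _ _ H), (ilm_cut _ _ _ H1), (ilm_cut _ _ _ (ilm_4 _ P)).
  solve_taut.
Qed.

(** If both premises hold by their box disjuncts, [reach_trans] applies. If the first holds by
    [iI (B \/ C)] and the second by its box, [I2] yields [iI (C \/ iDia C)] and [I3] yields
    [iI C]. *)
Lemma irhd_J2plus Ss r A B C :
  In I2 Ss -> In I3 Ss ->
  ilminus Ss (iAnd (irhd r A (B \/ C)) (irhd r B C) --> irhd r A C).
Proof.
  intros HI2 HI3.
  assert (H : ilminus Ss (iBox (B --> reach r C) --> iBox (B \/ C --> C \/ iDia C))) by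
    (apply ilm_box_mono; destruct r; solve_taut).
  pose proof (ilm_schema Ss I2 _ HI2 (I2_inst (B \/ C) (C \/ iDia C))) as H2.
  pose proof (ilm_schema Ss I3 _ HI3 (I3_inst C)) as H3.
  apply (ilm_cut _ _ _ H), (ilm_cut _ _ _ H2), (ilm_cut _ _ _ H3),
    (ilm_cut _ _ _ (reach_trans Ss r A B C)).
  solve_taut.
Qed.

Lemma interp_sound Rs Ss r A :
  (forall R B, In R Rs -> R B -> ilminus Ss (interp r B)) ->
  ILminus Rs A -> ilminus Ss (interp r A).
Proof.
  intros HRs HA.
  induction HA as [A HA|A B|A|A B C|A|R A HR HA|A B _ IHAB _ IHA|A _ IHA
                  |A B C _ IH|A B C _ IH].
  - apply ilm_taut; intro v; rewrite ieval_interp; apply HA.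
  (* The translation commutes with [-->] and [Box], so K and Löb are instances of themselves up to
     conversion. *)
  - apply ilm_K.
  - apply ilm_L.
  - apply irhd_J3.
  - apply irhd_J6.
  - exact (HRs R A HR HA).
  - exact (ilm_MP _ _ _ IHAB IHA).
  - exact (ilm_Nec _ _ IHA).
  - apply irhd_mono_r, IH.
  - apply irhd_anti_l, IH.
Qed.

Lemma interp_embed Ss r A :
  (forall B, ilminus Ss (iBox (reach r B) --> iI B)) ->
  ilminus Ss (interp r (embed A) <-> A).
Proof.
  intros Hr.
  induction A as [n| |A IHA B IHB|A IHA|A IHA]; cbn.
  - solve_taut.
  - solve_taut.
  - apply (ilm_cut _ _ _ IHA), (ilm_cut _ _ _ IHB); solve_taut.
  - assert (H1 : ilminus Ss (iBox (interp r (embed A)) --> iBox A)) by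
      (apply ilm_box_mono, (ilm_cut _ _ _ IHA); solve_taut).
    assert (H2 : ilminus Ss (iBox A --> iBox (interp r (embed A)))) by
      (apply ilm_box_mono, (ilm_cut _ _ _ IHA); solve_taut).
    apply (ilm_cut _ _ _ H1), (ilm_cut _ _ _ H2); solve_taut.
  - set (A' := interp r (embed A)) in *.
    assert (H1 : ilminus Ss (iI A' --> iI A)) by
      (apply ilm_RI, (ilm_cut _ _ _ IHA); solve_taut).
    assert (H2 : ilminus Ss (iI A --> iI A')) by
      (apply ilm_RI, (ilm_cut _ _ _ IHA); solve_taut).
    (* [iBot --> iBot] is the translation of [Top]; once it is dropped, [Hr] absorbs the box
       disjunct into [iI A']. *)
    assert (H3 : ilminus Ss (iBox ((iBot --> iBot) --> reach r A') -->
                             iBox (reach r A'))) by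
      (apply ilm_box_mono; solve_taut).
    apply (ilm_cut _ _ _ H1), (ilm_cut _ _ _ H2), (ilm_cut _ _ _ H3),
      (ilm_cut _ _ _ (Hr A')); solve_taut.
Qed.

Lemma box_dia_I Ss B : ilminus Ss (iBox (iDia B) --> iI B).
Proof.
  assert (H : ilminus Ss (iI iBot --> iI B)) by (apply ilm_RI; solve_taut).
  apply (ilm_cut _ _ _ H), (ilm_cut _ _ _ (ilm_box_dia Ss B)),
    (ilm_cut _ _ _ (ilm_IBot Ss)); solve_taut.
Qed.

Lemma box_or_dia_I Ss B :
  In J1u Ss -> In I3 Ss -> ilminus Ss (iBox (B \/ iDia B) --> iI B).
Proof.
  intros HJ1u HI3.
  apply (ilm_cut _ _ _ (ilm_schema Ss J1u _ HJ1u (J1u_inst (B \/ iDia B)))),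
    (ilm_cut _ _ _ (ilm_schema Ss I3 _ HI3 (I3_inst B))); solve_taut.
Qed.

Lemma interp_conservative Rs Ss r A :
  (forall R B, In R Rs -> R B -> ilminus Ss (interp r B)) ->
  (forall B, ilminus Ss (iBox (reach r B) --> iI B)) ->
  ILminus Rs (embed A) -> ilminus Ss A.
Proof.
  intros HRs Hr HA.
  apply (ilm_cut _ _ _ (interp_sound Rs Ss r _ HRs HA)),
    (ilm_cut _ _ _ (interp_embed Ss r A Hr)); solve_taut.
Qed.

Theorem theorem4p12 :
  (forall A : iform, ILminus [J2plus; J5] (embed A) -> ilminus [I2; I3] A) /\
  (forall A : iform, IL (embed A) -> ilminus [J1u; I2; I3] A).
Proof.
  split; intros A.
  - apply (interp_conservative _ _ false).
    + intros R B [<-|[<-|[]]] []; [apply irhd_J2plus; cbn; auto|apply irhd_J5].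
    + apply box_dia_I.
  (* Validating [J1] calls for the disjunct [B] in [reach]; [J1u] with [I3] makes up for it. *)
  - apply (interp_conservative _ _ true).
    + intros R B [<-|[<-|[<-|[]]]] [];
        [apply irhd_J1|apply irhd_J2plus; cbn; auto|apply irhd_J5].
    + intros B; apply box_or_dia_I; cbn; auto.
Qed.
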